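(* Let $(X,d)$ be a compact metric space, $\Lambda$ a finite nonempty set, and $\mathcal{F}=\{X; f_{\lambda}\mid\lambda\in\Lambda\}$ an iterated function system such that each $f_\lambda:X\to X$ is a homeomorphism. Suppose that $\mathcal{F}$ expands small distances, i.e. there are constants $\delta_0>0$ and $\alpha>1$ such that $d(f_\lambda(x),f_\lambda(y))>\alpha\, d(x,y)$ for all $\lambda\in\Lambda$ and all $x,y\in X$ with $0<d(x,y)<\delta_0$. Then the following conditions are equivalent: (i) $\mathcal{F}$ is an open IFS; (ii) $\mathcal{F}$ has the shadowing property; (iii) $\mathcal{F}$ has the Lipschitz shadowing property.
   Context: An iterated function system (IFS) $\mathcal{F}=\{X;f_\lambda\mid\lambda\in\Lambda\}$ is a family of continuous maps $f_\lambda:X\to X$ indexed by a finite nonempty set $\Lambda$. It is an open IFS if every $f_\lambda$ is an open map. For $\sigma=\{\ldots,\lambda_{-1},\lambda_0,\lambda_1,\ldots\}\in\Lambda^{\mathbb{Z}}$ (with every $f_\lambda$ a homeomorphism) put $\mathcal{F}_{\sigma_0}=\mathrm{id}$, and for $n\ge 1$, $\mathcal{F}_{\sigma_n}=f_{\lambda_{n-1}}\circ\cdots\circ f_{\lambda_0}$ and $\mathcal{F}_{\sigma_{-n}}=f_{\lambda_{-n}}^{-1}\circ f_{\lambda_{-(n-1)}}^{-1}\circ\cdots\circ f_{\lambda_{-1}}^{-1}$. A sequence $\{x_i\}_{i\in\mathbb{Z}}$ in $X$ is an orbit of $\mathcal{F}$ if there is $\sigma=\{\lambda_i\}_{i\in\mathbb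 Z}\in\Lambda^{\mathbb{Z}}$ with $x_{i+1}=f_{\lambda_i}(x_i)$ for all $i\in\mathbb{Z}$. For $\delta>0$, it is a $\delta$-pseudo orbit if there is $\sigma=\{\lambda_i\}_{i\in\mathbb Z}\in\Lambda^{\mathbb{Z}}$ with $d(x_{i+1},f_{\lambda_i}(x_i))<\delta$ for all $i\in\mathbb{Z}$. $\mathcal{F}$ has the shadowing property if for every $\epsilon>0$ there is $\delta>0$ such that for every $\delta$-pseudo orbit $\{x_i\}_{i\in\mathbb{Z}}$ there is an orbit $\{y_i\}_{i\in\mathbb{Z}}$ with $d(x_i,y_i)\le\epsilon$ for all $i\in\mathbb{Z}$. $\mathcal{F}$ has the Lipschitz shadowing property if there are $L>0$ and $\epsilon_0>0$ such that for every $0<\epsilon<\epsilon_0$ and every $\epsilon$-pseudo orbit $\{x_i\}_{i\in\mathbb{Z}}$ there exist $y\in X$ and $\sigma\in\Lambda^{\mathbb{Z}}$ with $d(\mathcal{F}_{\sigma_i}(y),x_i)<L\epsilon$ for all $i\in\mathbb{Z}$. *)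

(* Defs.v *)
From HB Require Import structures.
From mathcomp Require Import all_boot all_order all_algebra.
From mathcomp Require Import boolp classical_sets functions reals topology.

Set Implicit Arguments.
Unset Strict Implicit.
Unset Printing Implicit Defensive.

Import Order.TTheory GRing.Theory Num.Theory.

Local Open Scope classical_set_scope.
Local Open Scope ring_scope.

(* The default function [id] is irrelevant for a bijection [f]; it is the
   choice that does not require [X] to be pointed, so [X] may be empty. *)
Definition inverse_map (X : choiceType) (f : X -> X) : X -> X :=
  'pinv_id [set: X] f.

Lemma inverse_mapK (X : choiceType) (f : X -> X) :
  bijective f -> cancel f (inverse_map f).
Proof.
move=> /bij_inj f_inj x.
by apply: (pinvKV id (A := setT)) => //= [u v _ _|]; [exact: f_inj|rewrite inE].
Qed.

Lemma inverse_mapVK (X : choiceType) (f : X -> X) :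
  bijective f -> cancel (inverse_map f) f.
Proof. by move=> [g _ gK] x; apply: pinvK; rewrite inE; exists (g x). Qed.

Definition homeomorphism (X : topologicalType) (f : X -> X) : Prop :=
  [/\ bijective f, continuous f & continuous (inverse_map f)].

Definition open_map (X Y : topologicalType) (f : X -> Y) : Prop :=
  forall U : set X, open U -> open (f @` U).

Section IFS.
Variables (R : realType) (X : metricType R) (Lambda : finType).
Implicit Types (f : Lambda -> X -> X) (s : int -> Lambda) (x : int -> X).

Definition open_ifs f : Prop := forall l, open_map (f l).

Definition expands_small_distances f : Prop :=
  exists delta0 alpha : R, [/\ 0 < delta0, 1 < alpha &
    forall (l : Lambda) (u v : X), 0 < mdist u v -> mdist u v < delta0 ->
      alpha * mdist u v < mdist (f l u) (f l v)].

(* [iteri n g y] is [g n.-1 (... (g 0 y))], and [Negz n] is [- n.+1].  Hence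
   [ifs_iter f s n] is f_(s (n-1)) o ... o f_(s 0), and [ifs_iter f s (- n)]
   is (f_(s (-n)))^-1 o ... o (f_(s (-1)))^-1. *)
Definition ifs_iter f s (i : int) (y : X) : X :=
  match i with
  | Posz n => iteri n (fun k => f (s k%:Z)) y
  | Negz n => iteri n.+1 (fun k => inverse_map (f (s (- k.+1%:Z)))) y
  end.

Definition is_orbit f x : Prop :=
  exists s, forall i : int, x (i + 1) = f (s i) (x i).

Definition is_pseudo_orbit f (delta : R) x : Prop :=
  exists s, forall i : int, mdist (x (i + 1)) (f (s i) (x i)) < delta.

Definition shadowing_property f : Prop :=
  forall eps : R, 0 < eps -> exists2 delta : R, 0 < delta &
    forall x, is_pseudo_orbit f delta x ->
      exists2 y : int -> X, is_orbit f y &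
        forall i : int, mdist (x i) (y i) <= eps.

Definition lipschitz_shadowing_property f : Prop :=
  exists L eps0 : R, [/\ 0 < L, 0 < eps0 &
    forall eps : R, 0 < eps -> eps < eps0 ->
      forall x, is_pseudo_orbit f eps x ->
        exists (y : X) s, forall i : int,
          mdist (ifs_iter f s i y) (x i) < L * eps].

End IFS.

(* Main.v *)
(** The inverses of the maps contract small distances, by a uniform factor
    [1 / alpha] on pairs closer than some [rho].  Cover [X] by [N] sets of
    diameter less than [rho].  Given [N + 1] distinct points, two of their
    images under the [n]-th iterate of an [f l] lie in a common set of the
    cover, so these two points are within [rho / alpha ^ n] of each other;
    this fails for large [n].  Hence [X] is finite, therefore uniformly
    discrete, and every fine enough pseudo-orbit is an orbit.  So all three
    properties hold. *)
Require Import Defs.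
From HB Require Import structures.
From mathcomp Require Import all_boot all_order all_algebra.
From mathcomp Require Import boolp classical_sets functions reals topology.

Import Order.TTheory GRing.Theory Num.Theory.
Import numFieldTopology.Exports.

Local Open Scope classical_set_scope.
Local Open Scope ring_scope.

Lemma homeomorphism_open_map (X : topologicalType) (f : X -> X) :
  homeomorphism f -> open_map f.
Proof.
move=> [f_bij _ fV_cont] U U_open.
suff -> : f @` U = inverse_map f @^-1` U.
  by apply: open_comp => // x _; exact: fV_cont.
apply/seteqP; split=> [_ [x Ux <-]|y Uy] /=; first by rewrite inverse_mapK.
by exists (inverse_map f y) => //; rewrite inverse_mapVK.
Qed.

(** This passes from orbits given as sequences to the iterates of a point, as Lipschitz shadowing
    needs. Backwards in time, each inverse map undoes one step of the orbit. *)
Lemma ifs_iter_orbit (R : realType) (X : metricType R) (Lambda : finType)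
    (f : Lambda -> X -> X) (s : int -> Lambda) (x : int -> X) :
  (forall l, bijective (f l)) -> (forall i, x (i + 1) = f (s i) (x i)) ->
  forall i, ifs_iter f s i (x 0) = x i.
Proof.
move=> f_bij x_orbit; case=> n; rewrite /ifs_iter.
  elim: n => //= n ->.
  by rewrite -x_orbit -PoszD addn1.
(* Generalizing [n.+1] lets the induction start at index 0, where no inverse has been applied
   yet. *)
rewrite NegzE; elim: n.+1 => [|m IH] /=; first by rewrite oppr0.
rewrite IH; have -> : - m%:Z = - m.+1%:Z + 1 by rewrite intS opprD addrAC addNr add0r.
by rewrite x_orbit inverse_mapK.
Qed.

Section Metric.
Variables (R : realType) (X : metricType R).

Lemma compact_uniformly_continuous (h : X -> X) (eps : R) :
  compact [set: X] -> continuous h -> 0 < eps ->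
  exists2 rho : R, 0 < rho &
    forall u v, mdist u v < rho -> mdist (h u) (h v) < eps.
Proof.
move=> /compact_near_coveringP X_cov h_cont eps_gt0.
pose P (r : R) u := forall v, mdist u v < r -> mdist (h u) (h v) < eps.
(* Near-covering turns radii that work locally around each [u] into one that works on all of [X].
   For [r <= 0] the property [P r u] is vacuous, so a two-sided neighbourhood of 0 does no harm. *)
have /nbhs_ballP[d /= d_gt0 hd] : \forall r \near (0 : R), [set: X] `<=` P r.
  apply: (X_cov _ _ P (nbhs_filter _)) => u _.
  have eps2_gt0 : 0 < eps / 2 by rewrite divr_gt0.
  have /h_cont/nbhs_ballP[d /= d_gt0 hd] := nbhsx_ballx (h u) _ eps2_gt0.
  exists (ball u (d / 2), ball (0 : R) (d / 2)).
    by split; apply: nbhsx_ballx; rewrite divr_gt0.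
  move=> [w r] [] /=; rewrite ballEmdist /= => uw r_lt v wv.
  have hball z : mdist u z < d -> mdist (h u) (h z) < eps / 2.
    by have := hd z; rewrite !ballEmdist /=.
  have uv : mdist u v < d.
    apply: le_lt_trans (metric_triangle _ w _) _.
    rewrite [d]splitr ltrD // (lt_trans wv) //.
    by move: r_lt; rewrite /ball /= sub0r normrN => /ltr_normlW.
  apply: le_lt_trans (metric_triangle _ (h u) _) _.
  rewrite [mdist (h w) _]metric_sym [eps]splitr ltrD // hball //.
  by rewrite (lt_trans uw) // ltr_pdivrMr // ltr_pMr // ltr1n.
exists (d / 2); first by rewrite divr_gt0.
move=> u v; apply: hd => //=.
by rewrite /ball /= sub0r normrN gtr0_norm ?divr_gt0 // ltr_pdivrMr // ltr_pMr // ltr1n.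
Qed.

Lemma compact_finite_net (rho : R) : compact [set: X] -> 0 < rho ->
  exists c : seq X, forall x, exists2 z, z \in c & mdist z x < rho.
Proof.
move=> /compact_near_coveringP X_cov rho_gt0.
(* [compact_cover] is stated for pointed spaces only; instead, use near-covering
   along the filter of finite sequences directed by inclusion. *)
pose F := filter_from setT (fun s : seq X => [set c : seq X | {subset s <= c}]).
have F_filter : Filter F.
  apply: filter_from_filter; first by exists [::].
  move=> s t _ _; exists (s ++ t) => // c c_st.
  by split=> z z_in; apply: c_st; rewrite mem_cat z_in ?orbT.
pose P (c : seq X) x := exists2 z, z \in c & mdist z x < rho.
have [c _ c_net] : \forall c \near F, [set: X] `<=` P c.
  apply: (X_cov _ _ P F_filter) => x _.
  exists (ball x rho, [set c : seq X | {subset [:: x] <= c}]).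
    by split; [exact: nbhsx_ballx | exists [:: x]].
  move=> [y c] [] /=; rewrite ballEmdist /= => xy xc.
  by exists x => //; rewrite xc ?mem_head.
by exists c => x; apply: (c_net c).
Qed.

Lemma seq_separation (s : seq X) : exists2 eta : R, 0 < eta &
  forall u v, u \in s -> v \in s -> mdist u v < eta -> u = v.
Proof.
(* The default value 1 keeps the minimum positive when [s] has no two distinct members. *)
exists (\big[Num.min/1]_(p <- [seq (u, v) | u <- s, v <- s] | p.1 != p.2)
          mdist p.1 p.2).
  elim/big_ind: _ => [|a b a_gt0 b_gt0|p]; rewrite ?mdist_gt0 //.
  by rewrite lt_min a_gt0.
move=> u v us vs; apply: contraPeq => neq_uv; apply/negP; rewrite -leNgt.
by apply: (@ge_bigmin_seq _ _ _ _ _ (u, v)); rewrite ?allpairs_f.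
Qed.

(** A weak Bernoulli inequality bounds [alpha ^+ n] below by a linear function of [n]. *)
Lemma exprn_unbounded (alpha M : R) : 1 < alpha -> exists n, M < alpha ^+ n.
Proof.
move=> alpha_gt1.
have alphaB1_gt0 : 0 < alpha - 1 by rewrite subr_gt0.
exists (Num.truncn (M / (alpha - 1))).+1.
have bernoulli n : n%:R * (alpha - 1) <= alpha ^+ n.
  elim: n => [|n IH]; first by rewrite mul0r.
  have -> : alpha ^+ n.+1 = alpha ^+ n + (alpha - 1) * alpha ^+ n.
    by rewrite mulrBl mul1r -exprS addrC subrK.
  by rewrite -natr1 mulrDl mul1r lerD // ler_peMr ?exprn_ege1 // ltW.
apply: lt_le_trans (bernoulli _).
by rewrite -ltr_pdivrMr // truncnS_gt.
Qed.

Section Expanding.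
Variables (f h : X -> X) (delta0 alpha : R).
Hypotheses (fK : cancel f h) (hK : cancel h f).
Hypotheses (delta0_gt0 : 0 < delta0) (alpha_gt1 : 1 < alpha).
Hypothesis f_expands : forall u v, 0 < mdist u v -> mdist u v < delta0 ->
  alpha * mdist u v < mdist (f u) (f v).

(** Uniform continuity of [h] puts [h u] and [h v] within [delta0] of each other, so expansion by
    [f] reads as contraction by [h]. The contracted pair is still [rho]-close, which allows
    iteration. *)
Lemma inverse_iter_contracts : compact [set: X] -> continuous h ->
  exists2 rho : R, 0 < rho & forall n u v,
    mdist u v < rho -> alpha ^+ n * mdist (iter n h u) (iter n h v) <= mdist u v.
Proof.
move=> X_compact h_cont.
have [rho rho_gt0 h_unif] :=
  compact_uniformly_continuous _ _ X_compact h_cont delta0_gt0.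
have h_contracts u v : mdist u v < rho -> alpha * mdist (h u) (h v) <= mdist u v.
  move=> uv; have [huv0|] := eqVneq (h u) (h v).
    by rewrite huv0 mdistxx mulr0 mdist_ge0.
  rewrite -mdist_gt0 => huv_gt0.
  by have := f_expands _ _ huv_gt0 (h_unif _ _ uv); rewrite !hK => /ltW.
exists rho => //; elim=> [|n IH] u v uv; first by rewrite mul1r.
rewrite !iterSr exprSr.
have huv := h_contracts _ _ uv.
have huv_rho : mdist (h u) (h v) < rho.
  apply: le_lt_trans uv; apply: le_trans huv.
  by rewrite ler_peMl ?mdist_ge0 // ltW.
apply: le_trans huv; rewrite -mulrA mulrCA ler_pM2l ?IH //.
exact: lt_trans alpha_gt1.
Qed.

Lemma expanding_homeomorphism_finite : compact [set: X] -> continuous h ->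
  exists s : seq X, forall x, x \in s.
Proof.
move=> X_compact h_cont; apply: contrapT => X_infinite.
have iterK m : cancel (iter m f) (iter m h).
  by elim: m => // m IH x; rewrite iterSr /= fK.
have [rho rho_gt0 h_contracts] := inverse_iter_contracts X_compact h_cont.
have [c c_net] : exists c : seq X, forall x,
    exists2 z, z \in c & mdist z x < rho / 2.
  by apply: compact_finite_net; rewrite ?divr_gt0.
have [s s_uniq s_size] : exists2 s : seq X, uniq s & size s = (size c).+1.
  elim: (size c).+1 => [|n [s s_uniq <-]]; first by exists [::].
  have [x xs] : exists x, x \notin s.
    apply: contrapT => /forallNP s_full; apply: X_infinite; exists s => x.
    by have /negP := s_full x; rewrite negbK.
  by exists (x :: s); rewrite //= xs.
have [eta eta_gt0 s_sep] := seq_separation s.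
(* With this [n], contracting from [rho] by [alpha ^+ n] lands below the separation [eta] of [s]. *)
have [n n_large] := exprn_unbounded _ (rho / eta) alpha_gt1.
have /choice[F F_net] x : exists z, z \in c /\ mdist z (iter n f x) < rho / 2.
  by have [z zc zx] := c_net (iter n f x); exists z.
(* A shared centre makes the [n]-th images [rho]-close; pulled back by [iter n h], they are
   [eta]-close, hence equal. *)
have F_inj : {in s &, injective F}.
  move=> u v us vs Fuv; apply: s_sep => //.
  have [_ u_near] := F_net u; have [_ v_near] := F_net v.
  have fuv : mdist (iter n f u) (iter n f v) < rho.
    apply: le_lt_trans (metric_triangle _ (F u) _) _.
    by rewrite [mdist _ (F u)]metric_sym [rho]splitr ltrD // Fuv.
  have := h_contracts n _ _ fuv; rewrite !iterK => uv.
  have alphan_gt0 : 0 < alpha ^+ n by rewrite exprn_gt0 // (lt_trans _ alpha_gt1).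
  rewrite -(ltr_pM2l alphan_gt0); apply: le_lt_trans uv (lt_trans fuv _).
  by rewrite -ltr_pdivrMr.
have : (size (map F s) <= size c)%N.
  apply: uniq_leq_size; first by rewrite map_inj_in_uniq.
  by move=> _ /mapP[x _ ->]; have [] := F_net x.
by rewrite size_map s_size ltnn.
Qed.

End Expanding.
End Metric.

Theorem theorem3p4 (R : realType) (X : metricType R) (Lambda : finType)
    (f : Lambda -> X -> X) :
  compact [set: X] ->
  (0 < #|Lambda|)%N ->
  (forall l : Lambda, homeomorphism (f l)) ->
  expands_small_distances f ->
  (open_ifs f <-> shadowing_property f) /\
  (shadowing_property f <-> lipschitz_shadowing_property f).
Proof.
move=> X_compact /card_gt0P[l0 _] f_homeo [delta0 [alpha [d_gt0 a_gt1 f_exp]]].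
have f_bij l : bijective (f l) by have [] := f_homeo l.
have [s s_full] : exists s : seq X, forall x, x \in s.
  have [_ _ fV_cont] := f_homeo l0.
  exact: expanding_homeomorphism_finite (inverse_mapK (f_bij l0))
    (inverse_mapVK (f_bij l0)) d_gt0 a_gt1 (f_exp l0) X_compact fV_cont.
have [eta eta_gt0 X_sep] := seq_separation _ _ s.
(* A jump smaller than the separation [eta] of [X] is no jump at all. *)
have pseudo_orbitP eps x : eps <= eta -> is_pseudo_orbit f eps x ->
    exists s, forall i, x (i + 1) = f (s i) (x i).
  move=> le_eps [t xt]; exists t => i.
  by apply: X_sep; rewrite ?s_full // (lt_le_trans (xt i)).
have f_open : open_ifs f by move=> l; exact: homeomorphism_open_map.
have f_shad : shadowing_property f.
  move=> eps eps_gt0; exists eta => // x /pseudo_orbitP x_orbit.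
  by exists x => [|i]; [exact: x_orbit | rewrite mdistxx ltW].
have f_lip : lipschitz_shadowing_property f.
  (* The pseudo-orbit shadows itself at distance 0, so [L = 1] suffices. *)
  exists 1, eta; split=> // eps eps_gt0 lt_eps x.
  move=> /(pseudo_orbitP _ _ (ltW lt_eps))[t x_orbit].
  by exists (x 0), t => i; rewrite ifs_iter_orbit // mdistxx mul1r.
by split; split.
Qed.
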